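(* Let $\lambda=(\lambda_1,\dots,\lambda_\ell)$ be a partition of length $\ell$, and let $\mathbf{x}=(x_1,\dots,x_n)$ and $\mathbf{t}=(t_1,\dots,t_{\ell-1})$ be commuting indeterminates. Then $$g_\lambda(\mathbf{x};\mathbf{t})=\det\bigl[h_{\lambda_i+j-i}(x_1,\dots,x_n,t_1,\dots,t_{i-1})\bigr]_{i,j=1}^{\ell}.$$
   Context: A reverse plane partition of shape $\lambda$ (English convention, row 1 at the top) is a filling of the boxes of $\lambda$ with positive integers that weakly increases along rows and down columns. Let $\mathrm{RPP}^n(\lambda)$ be the set of those with all entries at most $n$. For $T\in\mathrm{RPP}^n(\lambda)$, let $a_i$ be the number of columns of $T$ containing $i$, and let $b_r$ be the number of boxes in row $r$ whose entry equals the entry in the box directly below. The refined dual Grothendieck polynomial is $g_\lambda(\mathbf{x};\mathbf{t}):=\sum_{T\in\mathrm{RPP}^n(\lambda)}\prod_{r}t_r^{b_r}\prod_{i}x_i^{a_i}$. Here $h_k$ is the complete homogeneous symmetric polynomial of degree $k$, with $h_0=1$ and $h_k=0$ for $k<0$. *)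

(* Defs.v *)
From mathcomp Require Import all_boot all_order all_algebra.
From mathcomp.multinomials Require Import mpoly.

Set Implicit Arguments.
Unset Strict Implicit.
Unset Printing Implicit Defensive.

Import GRing.Theory.
Local Open Scope ring_scope.

(* Rows, columns, parts, variables and entries are all indexed from 0, so that
   [tnth la i] is the part lambda_(i+1). *)

Definition is_partition l (la : l.-tuple nat) : bool :=
  sorted geq la && (0%N \notin (la : seq nat)).

Section ReversePlanePartitions.
Variables (l : nat) (la : l.-tuple nat) (n : nat).

Definition box : finType := {r : 'I_l & 'I_(tnth la r)}.
Definition box_row (u : box) : nat := tag u.
Definition box_col (u : box) : nat := tagged u.

(* The value k : 'I_n stands for the entry k + 1 in {1, ..., n}. *)
Definition filling : finType := {ffun box -> 'I_n}.

Definition is_rpp (T : filling) : bool :=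
  [forall u : box, forall v : box,
     ((box_row u == box_row v) && (box_col u <= box_col v)%N ==> (T u <= T v)%N) &&
     ((box_col u == box_col v) && (box_row u <= box_row v)%N ==> (T u <= T v)%N)].

(* Columns are indexed by 'I_(head 0 la), since the first row is the longest. *)
Definition ncols_with (T : filling) (i : 'I_n) : nat :=
  #|[set c : 'I_(head 0%N la) | [exists u : box, (box_col u == c) && (T u == i)]]|.

Definition nrepeats_below (T : filling) (r : nat) : nat :=
  #|[set u : box | (box_row u == r) &&
      [exists v : box, [&& box_row v == r.+1, box_col v == box_col u & T v == T u]]]|.

End ReversePlanePartitions.

(* Polynomials in x_1, ..., x_n, t_1, ..., t_(l-1); the variables x come first. *)
Definition xvar n l (i : 'I_n) : {mpoly int[n + l.-1]} := 'X_(lshift l.-1 i).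
Definition tvar n l (r : 'I_l.-1) : {mpoly int[n + l.-1]} := 'X_(rshift n r).

Definition refined_dual_grothendieck n l (la : l.-tuple nat) : {mpoly int[n + l.-1]} :=
  \sum_(T : filling la n | is_rpp T)
    (\prod_(r < l.-1) tvar n r ^+ nrepeats_below T r) *
    (\prod_(i < n) xvar l i ^+ ncols_with T i).

(* h_k(s) is the sum of s_(w_1) ... s_(w_k) over all weakly increasing words
   w_1 <= ... <= w_k of positions in s. *)
Definition complete_homogeneous (R : comNzRingType) (s : seq R) (k : int) : R :=
  match k with
  | Posz m => \sum_(w : m.-tuple 'I_(size s) | sorted leq [seq val i | i <- w])
                \prod_(i <- w) s`_i
  | Negz _ => 0
  end.

Definition xvars n l : seq {mpoly int[n + l.-1]} := [seq xvar l i | i <- enum 'I_n].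
Definition tvars n l : seq {mpoly int[n + l.-1]} := [seq tvar n r | r <- enum 'I_l.-1].

(* Main.v *)
Require Import Defs.
From mathcomp Require Import all_boot all_order all_algebra.
From mathcomp.multinomials Require Import mpoly.
From mathcomp Require Import ring zify.

Import GRing.Theory.
Local Open Scope ring_scope.

(* Induction on the number of x-variables. In a reverse plane partition of shape
   la with entries at most k+1, the entries at most k occupy a shape mu inside
   la, and the boxes of la / mu contribute a product over the rows r of powers of
   y = x_(k+1) and t_r that depends only on la and on mu_r. So the claim is the
   recursion D_(k+1)(la) = \sum_mu weight(la / mu) * D_k(mu) for the determinants
   D_k built from the variables x_1, ..., x_k and t.
   Write u_i(a) and v_i(a) for the i-th row with part a in D_k and D_(k+1).
   Subtracting a multiple of v_(i+1)(la_(i+1)) turns v_i(la_i) into a sum of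
   w(a) u_i(a), a <= la_i, whose terms with a < b add up, for each
   b <= la_(i+1), to a multiple of u_(i+1)(b). Expanding the rows from the bottom
   upwards, once mu_(i+1) = b is chosen only the terms with a >= b survive: these
   are exactly the weakly decreasing mu. *)

Set Implicit Arguments.
Unset Strict Implicit.
Unset Printing Implicit Defensive.

(** * Complete homogeneous polynomials: splitting off one variable *)

Lemma all_neq_ord0_lift m (w : seq 'I_m.+1) :
  all (fun i => i != ord0) w -> exists w', w = [seq lift ord0 i | i <- w'].
Proof.
elim: w => [|i w IHw] /=; first by exists [::].
case/andP=> i0 /IHw[w' ->].
by case: (unliftP ord0 i) i0 => [j ->|->]; [exists (j :: w') | rewrite eqxx].
Qed.

Section CompleteHomogeneous.
Variable R : comNzRingType.
Implicit Types (a : R) (s : seq R) (m : int).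
Local Notation h := complete_homogeneous.

Lemma complete_homogeneous0 s : h s 0 = 1.
Proof.
rewrite /= (big_pred1 [tuple]) ?big_nil// => w.
by rewrite (tuple0 w).
Qed.

Lemma complete_homogeneous_lt0 s m : m < 0 -> h s m = 0.
Proof. by case: m. Qed.

Lemma complete_homogeneous_nil m : h ([::] : seq R) m = (m == 0)%:R.
Proof.
case: m => [[|m]|m] //; first exact: complete_homogeneous0.
by rewrite /= big_pred0 // => w; case: (thead w).
Qed.

(** Words are split by their first letter: those starting at [a] lose that letter, the others avoid
    [a] altogether because they are sorted. *)
Lemma complete_homogeneous_cons a s m :
  h (a :: s) m = h s m + a * h (a :: s) (m - 1).
Proof.
case: m => [[|m]|m]; last by rewrite /= mulr0 addr0.
  by rewrite [h (a :: s) (Posz 0)]complete_homogeneous0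
    [h s (Posz 0)]complete_homogeneous0 complete_homogeneous_lt0 // mulr0 addr0.
have -> : m.+1%:Z - 1 = m by rewrite -addn1 PoszD addrK.
rewrite /h (bigID (fun w : m.+1.-tuple 'I_(size (a :: s)) => thead w == ord0)) /=.
rewrite addrC; congr (_ + _).
  pose lift_word (w : m.+1.-tuple 'I_(size s)) := [tuple of map (lift ord0) w].
  have lift_inj : injective lift_word.
    move=> v w /(congr1 val) /= /(inj_map (@lift_inj _ ord0)); exact: val_inj.
  have sorted_lift (w : seq 'I_(size s)) :
      sorted leq [seq val i | i <- [seq lift ord0 i | i <- w]]
      = sorted leq [seq val i | i <- w].
    by rewrite !sorted_map; apply: eq_sorted => i j; rewrite /= /bump.
  rewrite [RHS](eq_bigr (fun w => \prod_(i <- lift_word w) (a :: s)`_i)); last first.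
    by move=> w _; rewrite big_map; apply: eq_bigr => i _; rewrite lift0.
  rewrite -(big_imset (A := fun w : m.+1.-tuple 'I_(size s) =>
      sorted leq [seq val i | i <- w]) (fun w : m.+1.-tuple 'I_(size (a :: s)) =>
    \prod_(i <- w) (a :: s)`_i)) /=; last by move=> v w _ _; exact: lift_inj.
  apply: eq_bigl => w; apply/andP/imsetP => [[sw w0]|[v]]; last first.
    rewrite unfold_in => sv ->; rewrite sorted_lift sv; split=> //.
    by rewrite /thead tnth_map eq_sym neq_lift.
  have /all_neq_ord0_lift[w' w'E] : all (fun i => i != ord0) w.
    case/tupleP: w sw w0 => i w /=; rewrite theadE => sw i0; rewrite i0 /=.
    apply/allP => j jw; move: sw; rewrite (path_sortedE leq_trans) => /andP[/allP iw _].
    have /iw : val j \in [seq val i | i <- w] by apply: map_f.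
    by rewrite -!lt0n in i0 * => /(leq_trans i0).
  have w's : size w' == m.+1 by rewrite -(size_tuple w) w'E size_map.
  exists (Tuple w's); last exact/val_inj.
  by rewrite unfold_in -sorted_lift -w'E.
(* Prepending the least letter keeps a word sorted. *)
rewrite (reindex_onto (fun w : m.-tuple 'I_(size (a :: s)) => [tuple of ord0 :: w])
  (fun w => [tuple of behead w])) /=; last first.
  by move=> w /andP[_ /eqP w0]; rewrite [RHS]tuple_eta w0.
rewrite mulr_sumr; apply: eq_big => [w|w _].
  rewrite theadE eqxx andbT [X in _ && X](_ : _ = true) ?andbT; last first.
    by apply/eqP/val_inj.
  by case: (val w).
by rewrite big_cons.
Qed.

(* Double induction: on [s1], and on the degree to cancel the head variable. *)
Lemma complete_homogeneous_insert s1 a s2 m :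
  h (s1 ++ a :: s2) m = h (s1 ++ s2) m + a * h (s1 ++ a :: s2) (m - 1).
Proof.
elim: s1 m => [|b s1 IHs] m; first exact: complete_homogeneous_cons.
case: m => m; last by rewrite /= mulr0 addr0.
elim: m => [|m IHm].
  by rewrite [h _ (Posz 0)]complete_homogeneous0
    [h (_ ++ s2) (Posz 0)]complete_homogeneous0 complete_homogeneous_lt0 // mulr0 addr0.
rewrite !cat_cons complete_homogeneous_cons [h (b :: s1 ++ s2) _]complete_homogeneous_cons.
rewrite [h (b :: s1 ++ a :: s2) (_.+1%:Z - 1) in X in _ = _ + X]complete_homogeneous_cons.
have -> : m.+1%:Z - 1 = m by rewrite -addn1 PoszD addrK.
rewrite IHs.
have := IHm; rewrite !cat_cons => ->.
have -> : m.+1%:Z - 1 = m by rewrite -addn1 PoszD addrK.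
ring.
Qed.
End CompleteHomogeneous.

(** * Determinants as functions of their rows *)

Section Rows.
Variables (R : comNzRingType) (l : nat).
Implicit Types (F : 'I_l -> 'rV[R]_l) (x : 'rV[R]_l).

Definition det_with_row F k x : R :=
  \det (\matrix_(i < l) (if i == k then x else F i)).

(** Expansion along row [k]. The cofactors do not see that row, so it is set to 0 there, which makes
    linearity in [x] visible. *)
Lemma det_with_rowE F k x :
  det_with_row F k x =
  \sum_j x 0 j * cofactor (\matrix_(i < l) (if i == k then 0 else F i)) k j.
Proof.
rewrite /det_with_row (expand_det_row _ k); apply: eq_bigr => j _.
rewrite mxE eqxx; congr (_ * (_ * \det _)).
by apply/matrixP => i i'; rewrite !mxE [_ == k]eq_sym (negPf (neq_lift _ _)).
Qed.

Lemma det_with_row_sum F k (I : Type) (r : seq I) (P : pred I) c (U : I -> 'rV_l) :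
  det_with_row F k (\sum_(a <- r | P a) c a *: U a) =
  \sum_(a <- r | P a) c a * det_with_row F k (U a).
Proof.
under [RHS]eq_bigr do rewrite det_with_rowE mulr_sumr.
rewrite exchange_big det_with_rowE; apply: eq_bigr => j _.
by rewrite summxE mulr_suml; apply: eq_bigr => a _; rewrite mxE mulrA.
Qed.

Lemma det_with_rowDZ F k c x y :
  det_with_row F k (x + c *: y) = det_with_row F k x + c * det_with_row F k y.
Proof.
rewrite !det_with_rowE mulr_sumr -big_split; apply: eq_bigr => j _ /=.
by rewrite !mxE mulrDl mulrA.
Qed.

Lemma det_with_row0 F k : det_with_row F k 0 = 0.
Proof. by rewrite det_with_rowE big1 // => j _; rewrite mxE mul0r. Qed.

Lemma det_with_row_dup F k j : j != k -> det_with_row F k (F j) = 0.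
Proof.
move=> jk; apply: (determinant_alternate jk) => i.
by rewrite !mxE eqxx (negPf jk).
Qed.

Lemma det_rows_add_next (V W : nat -> 'rV[R]_l) (c : nat -> R) :
    (forall i, (i < l)%N -> V i = W i + c i *: V i.+1) -> V l = 0 ->
  \det (\matrix_(i < l) V i) = \det (\matrix_(i < l) W i).
Proof.
move=> VW Vl0.
(* [A] is upper unitriangular and sends the rows [V] to the rows [W]; in the last row, [V l = 0]
   makes [V] and [W] agree. *)
pose A : 'M[R]_l := \matrix_(i, j) ((i == j)%:R - c i *+ (j == i.+1 :> nat)).
have trigA : is_trig_mx A^T.
  apply/is_trig_mxP => i j ij; rewrite !mxE.
  by rewrite -val_eqE /= (gtn_eqF ij) ltn_eqF ?mulr0n ?subr0 // ltnW.
have detA : \det A = 1.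
  rewrite -det_tr det_trig // big1 // => i _.
  by rewrite !mxE eqxx ltn_eqF // mulr0n subr0.
rewrite -[LHS]mul1r -detA -det_mulmx; congr (\det _).
apply/row_matrixP => i; rewrite rowK row_mul mulmx_sum_row.
under eq_bigr do rewrite !mxE rowK scalerBl.
rewrite big_split /= sumrN (bigD1 i) //= eqxx scale1r big1 ?addr0; last first.
  by move=> j /negPf ji; rewrite eq_sym ji scale0r.
have [iS|iS] := ltnP i.+1 l.
  rewrite (bigD1 (Ordinal iS)) //= eqxx mulr1n big1 ?addr0; last first.
    by move=> j /negPf ji; rewrite (_ : _ == _ = false) ?mulr0n ?scale0r.
  by rewrite (VW i) // addrK.
rewrite big1 ?subr0 => [|j _].
  rewrite (VW i) //; have -> : i.+1 = l by have := ltn_ord i; lia.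
  by rewrite Vl0 scaler0 addr0.
by rewrite ltn_eqF ?mulr0n ?scale0r // (leq_trans (ltn_ord j)).
Qed.

End Rows.

(** * Shapes as bounded families of row lengths *)

Definition row_lengths (l N : nat) : finType := {ffun 'I_l -> 'I_N.+1}.

Section Shapes.
Variables (l N : nat).
Implicit Types (la mu : row_lengths l N).

(* Trailing rows are empty. *)
Definition part mu (r : nat) : nat := oapp (fun i => val (mu i)) 0%N (insub r).

Lemma part_ord mu (i : 'I_l) : part mu i = mu i.
Proof. by rewrite /part valK. Qed.

Lemma part_default mu r : (l <= r)%N -> part mu r = 0%N.
Proof. by move=> lr; rewrite /part insubN // -leqNgt. Qed.

Lemma part_le mu r : (part mu r <= N)%N.
Proof.
have [rl|/part_default->//] := ltnP r l.
by rewrite (part_ord mu (Ordinal rl)) -ltnS.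
Qed.

Definition is_shape mu := [forall i : 'I_l, (part mu i.+1 <= part mu i)%N].

Definition sub_shape mu la := [forall i : 'I_l, (part mu i <= part la i)%N].

Lemma is_shapeP mu :
  reflect {homo part mu : r s / (r <= s)%N >-> (s <= r)%N} (is_shape mu).
Proof.
apply: (iffP forallP) => [dec_mu r s /subnK <-|dec_mu i]; last exact: dec_mu.
elim: (s - r)%N => // d; apply: leq_trans; rewrite addSn.
have [rl|/leqW lr] := ltnP (d + r) l; last by rewrite part_default.
exact: (dec_mu (Ordinal rl)).
Qed.

Lemma sub_shapeP mu la :
  reflect (forall r, (part mu r <= part la r)%N) (sub_shape mu la).
Proof.
apply: (iffP forallP) => // le_mu r.
have [rl|/part_default->//] := ltnP r l; exact: (le_mu (Ordinal rl)).
Qed.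

Lemma eq_shape la mu : (forall i, (i < l)%N -> part la i = part mu i) -> la = mu.
Proof.
move=> eq_part; apply/ffunP => i; apply/val_inj.
by rewrite /= -!part_ord eq_part.
Qed.

Definition set_part mu (k : 'I_l) (a : 'I_N.+1) : row_lengths l N :=
  [ffun i => if i == k then a else mu i].

Lemma part_set mu k a r :
  part (set_part mu k a) r = if r == k then val a else part mu r.
Proof.
have [rl|lr] := ltnP r l.
  rewrite (part_ord _ (Ordinal rl)) ffunE -val_eqE /=.
  by case: ifP => // _; rewrite -part_ord.
by rewrite !part_default // gtn_eqF // (leq_trans _ lr).
Qed.

End Shapes.

Lemma big_nat_ord_widen (V : nmodType) (b c N : nat) (F : nat -> V) :
    (c <= N)%N ->
  \sum_(b <= a < c.+1) F a = \sum_(a < N.+1 | (b <= a <= c)%N) F a.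
Proof.
move=> cN; rewrite big_geq_mkord /= (big_ord_widen_cond N.+1) //.
Qed.

(** * The recursion for the determinants when one variable is added *)

Section Transfer.
Variables (R : comNzRingType) (l N : nat) (y : R) (t : nat -> R).

(* The weight of row [r] of the skew shape [la / mu] filled with the variable
   [y]: its boxes with no box of the skew shape below count for [y], the others
   for [t r]. *)
Definition row_weight (la mu : nat -> nat) r : R :=
  y ^+ (la r - maxn (mu r) (la r.+1)) * t r ^+ (la r.+1 - mu r).

(** Unrolls the recursion from [d] down to [b]. It serves for [v i] with ratio [y] and for [u i.+1]
    with ratio [t i]. *)
Lemma affine_rec (V : lmodType R) (q : R) (f g : nat -> V) b d :
    (forall a, f a.+1 = q *: f a + g a) -> (b <= d)%N ->
  f d = \sum_(b <= a < d) q ^+ (d - a.+1) *: g a + q ^+ (d - b) *: f b.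
Proof.
move=> f_rec /subnK <-; elim: (d - b)%N => [|e IHe].
  by rewrite add0n big_geq // subnn expr0 scale1r add0r.
rewrite addSn f_rec IHe big_nat_recr ?leq_addl //= subnn expr0 scale1r.
rewrite scalerDr scalerA -exprS -subSn ?leq_addl // [RHS]addrAC; congr (_ + _ + _).
rewrite scaler_sumr; apply: eq_big_nat => a /andP[_ ale].
by rewrite scalerA -exprS -subSn.
Qed.

(** These become [jt_row] with [k] and with [k.+1] of the x-variables, [y] being the added one. *)
Variables u v : nat -> nat -> 'rV[R]_l.
Hypothesis u_rec : forall i a, u i.+1 a.+1 = t i *: u i.+1 a + u i a.
Hypothesis v_rec : forall i a, v i.+1 a.+1 = t i *: v i.+1 a + v i a.
Hypothesis v_add_var : forall i a, v i a.+1 = y *: v i a + u i a.+1.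
Hypotheses (u_last : u l 0 = 0) (v_last : v l 0 = 0).

Variable la : row_lengths l N.
Hypothesis la_shape : is_shape la.
Local Notation p := (part la).

Let p_dec i : (p i.+1 <= p i)%N. Proof. exact: (is_shapeP _ la_shape). Qed.

(* What is left of [v i (p i)] after subtracting a multiple of the next row. *)
Definition reduced_row i : 'rV[R]_l :=
  \sum_(p i.+1 <= a < (p i).+1) y ^+ (p i - a) *: u i a +
  (y ^+ (p i - p i.+1) * t i) *: u i.+1 (p i.+1).

Lemma v_reduced i :
  v i (p i) = reduced_row i + (y ^+ (p i - p i.+1) * (y - t i)) *: v i.+1 (p i.+1).
Proof.
rewrite (affine_rec (v_add_var i) (p_dec i)) /reduced_row.
rewrite [X in _ = X + _ + _]big_ltn ?ltnS // big_add1 /=.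
(* With [b = p i.+1], comparing the two formulas for [v i.+1 b.+1] gives $v_i(b) = u_i(b) + t_i
   u_{i+1}(b) + (y - t_i) v_{i+1}(b)$. *)
apply/rowP => j; move: (v_add_var i.+1 (p i.+1)) => /(congr1 (fun x : 'rV_l => x 0 j)).
rewrite v_rec u_rec !mxE => /(canRL (addKr _)) ->; ring.
Qed.

Lemma det_reduced :
  \det (\matrix_(i < l) v i (p i)) = \det (\matrix_(i < l) reduced_row i).
Proof.
apply: (det_rows_add_next (V := fun i => v i (p i)) (W := reduced_row)) => [i _|].
  exact: v_reduced.
by rewrite part_default.
Qed.

(** Unrolling [u i.+1 (p i.+1)] down to [b] turns the coefficient of each [u i a] into the
    [row_weight] of row [i] with part [a], and leaves one multiple of [u i.+1 b]. *)
Lemma reduced_rowE i b : (b <= p i.+1)%N ->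
  reduced_row i = \sum_(b <= a < (p i).+1)
    (y ^+ (p i - maxn a (p i.+1)) * t i ^+ (p i.+1 - a)) *: u i a +
    (y ^+ (p i - p i.+1) * t i ^+ (p i.+1 - b).+1) *: u i.+1 b.
Proof.
move=> bp; rewrite /reduced_row (affine_rec (u_rec i) bp).
rewrite [X in _ = X + _](big_cat_nat (n := p i.+1)) ?(leqW (p_dec i)) //= scalerDr.
rewrite addrA scaler_sumr; congr (_ + _); last first.
  by rewrite scalerA -mulrA -exprS.
rewrite addrC; congr (_ + _); apply: eq_big_nat => a /andP[ba ap].
  by rewrite scalerA (maxn_idPr (ltnW ap)) -mulrA -exprS -subSn.
have /eqP -> : (p i.+1 - a == 0)%N by [].
by rewrite (maxn_idPl ba) mulr1.
Qed.

(** The rows above [k] are pinned to 0, so that each choice of the lower parts is represented by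
    exactly one [mu]. *)
Definition lower_shape k (mu : row_lengths l N) :=
  [forall i : 'I_l, if (i < k)%N then part mu i == 0%N
                    else (part mu i.+1 <= part mu i <= p i)%N].

(* The rows from the [k]-th on are already expanded, with the parts of [mu]. *)
Definition mixed_det k (mu : row_lengths l N) : R :=
  (\prod_(r < l | (k <= r)%N) row_weight p (part mu) r) *
  \det (\matrix_(i < l) (if (i < k)%N then reduced_row i else u i (part mu i))).

(** The cut [b] in [reduced_rowE] is the part already chosen for the next row. The leftover multiple
    of [u k.+1 b] then repeats that row and contributes 0; linearity in row [k] gives the sum. *)
Lemma mixed_det_step (k : 'I_l) mu : lower_shape k.+1 mu ->
  mixed_det k.+1 mu =
  \sum_(a < N.+1 | (part mu k.+1 <= a <= p k)%N) mixed_det k (set_part mu k a).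
Proof.
move=> /forallP low_mu.
pose F (i : 'I_l) := if (i < k)%N then reduced_row i else u i (part mu i).
have mu_le : (part mu k.+1 <= p k.+1)%N.
  have [kl|/part_default->//] := ltnP k.+1 l.
  by have := low_mu (Ordinal kl); rewrite ltnn => /andP[].
have detF x G : G =1 (fun i : 'I_l => if i == k then x else F i) ->
    \det (\matrix_(i < l) G i) = det_with_row F k x.
  by move=> GF; congr (\det _); apply/row_matrixP => i; rewrite !rowK GF.
rewrite /mixed_det (detF (reduced_row k)); last first.
  move=> i; rewrite /F ltnS -val_eqE /=.
  by case: ltngtP => // /val_inj->.
rewrite (reduced_rowE mu_le) det_with_rowDZ det_with_row_sum.
have -> : det_with_row F k (u k.+1 (part mu k.+1)) = 0.
  (* Below the last row there is nothing to repeat; there the cut is 0 and [u l 0] vanishes. *)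
  have [kl|lk] := ltnP k.+1 l; last first.
    rewrite part_default // (_ : k.+1 = l) ?u_last ?det_with_row0 //.
    by apply/eqP; rewrite eqn_leq lk ltn_ord.
  have -> : u k.+1 (part mu k.+1) = F (Ordinal kl) by rewrite /F /= ltnNge leqW.
  by rewrite det_with_row_dup // -val_eqE /= gtn_eqF.
rewrite mulr0 addr0 (big_nat_ord_widen _ _ (part_le la k)) mulr_sumr.
apply: eq_bigr => a _; rewrite (detF (u k a)); last first.
  move=> i; rewrite part_set /F -val_eqE.
  by case: ltngtP => //= /val_inj ->.
rewrite [in RHS](bigD1 k) //= {2}/row_weight part_set eqxx mulrA; congr (_ * _).
rewrite mulrC; congr (_ * _); apply: eq_big => [r|r kr].
  by rewrite -val_eqE /= ltn_neqAle eq_sym andbC.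
by rewrite /row_weight part_set gtn_eqF.
Qed.

Lemma lower_shape_set0 (k : 'I_l) mu :
  lower_shape k.+1 (set_part mu k ord0) && (part mu k.+1 <= part mu k <= p k)%N =
  lower_shape k mu.
Proof.
apply/andP/forallP => [[/forallP low0 mu_k] i|low_mu].
  have := low0 i; rewrite !part_set ltnS /=.
  case: ltngtP => [//|ki|/val_inj-> //].
  by rewrite gtn_eqF // ltnW.
split; last by have := low_mu k; rewrite ltnn.
apply/forallP => i; have := low_mu i; rewrite !part_set ltnS /=.
by case: ltngtP => // ki; rewrite gtn_eqF // ltnW.
Qed.

(** Downward induction on [k]: at [k = l] nothing is expanded yet and [lower_shape] admits only the
    zero family. *)
Lemma det_reduced_expand k : (k <= l)%N ->
  \det (\matrix_(i < l) reduced_row i) = \sum_(mu | lower_shape k mu) mixed_det k mu.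
Proof.
move=> /subnKC; move: (l - k)%N => d; elim: d k => [|d IHd] k kd.
  rewrite addn0 in kd; rewrite kd (big_pred1 [ffun=> ord0]) => [|mu].
    rewrite /mixed_det big_pred0 ?mul1r => [|i]; last by rewrite leqNgt ltn_ord.
    by congr (\det _); apply/row_matrixP => i; rewrite !rowK ltn_ord.
  apply/forallP/eqP => [low_mu|-> i].
    apply: eq_shape => i il; rewrite (part_ord [ffun=> _] (Ordinal il)) ffunE.
    by have := low_mu (Ordinal il); rewrite il => /eqP.
  by rewrite ltn_ord part_ord ffunE.
have kl : (k < l)%N by rewrite -kd addnS ltnS leq_addr.
rewrite (IHd k.+1) ?addSnnS //.
pose K := Ordinal kl.
rewrite (eq_bigr _ (@mixed_det_step K)) pair_big_dep /=.
(* A family [nu] corresponds to the pair formed by [nu] with row [K] reset to 0 and by its part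
   [nu K]. *)
rewrite (reindex_onto (fun nu : row_lengths l N => (set_part nu K ord0, nu K))
  (fun q => set_part q.1 K q.2)) /=; last first.
  move=> [mu a] /= /andP[/forallP low_mu _]; congr (_, _); last by rewrite ffunE eqxx.
  apply/eq_shape => i il; rewrite !part_set; case: eqP => // ik.
  by have := low_mu K; rewrite ltnSn ik => /eqP.
have set_setK nu : set_part (set_part nu K ord0) K (nu K) = nu.
  by apply/ffunP => i; rewrite !ffunE; case: eqP => [->|].
apply: eq_big => [nu|nu _]; rewrite set_setK // eqxx andbT.
by rewrite -(lower_shape_set0 K) part_set gtn_eqF // (part_ord nu K).
Qed.

Lemma det_transfer :
  \det (\matrix_(i < l) v i (p i)) =
  \sum_(mu | is_shape mu && sub_shape mu la)
    (\prod_(r < l) row_weight p (part mu) r) * \det (\matrix_(i < l) u i (part mu i)).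
Proof.
rewrite det_reduced (det_reduced_expand (leq0n l)); apply: eq_bigl => mu.
apply/forallP/andP => [low_mu|[/forallP dec_mu /forallP le_mu] i].
  by split; apply/forallP => i; case/andP: (low_mu i).
by apply/andP; split.
Qed.

End Transfer.

(** * Iterated recursions as sums over paths *)

Section PathSums.
Variables (R : comNzRingType) (A : finType) (n : nat).
Variables (w : nat -> A -> A -> R) (f : nat -> A -> R).
Hypothesis f_rec : forall k a, (k < n)%N -> f k.+1 a = \sum_b w k a b * f k b.
Implicit Types C : {ffun 'I_n.+1 -> A}.

Definition level C i : A := C (inord i).

(** A path of length [k] is encoded by its constant continuation, so that paths of all lengths share
    one index type and induction on [k] applies. *)
Lemma path_sum_prefix k a : (k <= n)%N ->
  f k a = \sum_(C : {ffun 'I_n.+1 -> A} | [forall i : 'I_n.+1, (k <= i)%N ==> (C i == a)])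
            (\prod_(i < k) w i (level C i.+1) (level C i)) * f 0 (level C 0).
Proof.
elim: k a => [|k IHk] a kn.
  rewrite (big_pred1 [ffun=> a]) => [|C]; first by rewrite big_ord0 mul1r /level ffunE.
  apply/forallP/eqP => [Ca|-> i]; last by rewrite ffunE eqxx implybT.
  by apply/ffunP => i; rewrite ffunE; apply/eqP; have := Ca i; rewrite leq0n.
rewrite f_rec //; under eq_bigr do rewrite IHk ?(ltnW kn) // mulr_sumr.
pose trunc C : {ffun 'I_n.+1 -> A} := [ffun i : 'I_n.+1 => level C (minn i k)].
pose ext C : {ffun 'I_n.+1 -> A} := [ffun i : 'I_n.+1 => if (i <= k)%N then C i else a].
have levelE C (i : 'I_n.+1) : C i = level C i by rewrite /level inord_val.
have level_trunc C i : (i <= n)%N -> level (trunc C) i = level C (minn i k).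
  by move=> iN; rewrite [LHS]ffunE inordK.
have level_ext C i : (i <= n)%N -> level (ext C) i = if (i <= k)%N then level C i else a.
  by move=> iN; rewrite [LHS]ffunE inordK.
(* A path of length [k.+1] splits into its value at level [k] and the path frozen from level [k] on;
   [ext] restores the end point [a]. *)
rewrite pair_big_dep (reindex_onto (fun C => (level C k, trunc C)) (fun q => ext q.2)) /=.
  apply: eq_big => [C|C /andP[_ /eqP ext_trunc]].
    transitivity (ext (trunc C) == C).
      rewrite andb_idl // => _; apply/forallP => i; apply/implyP => ki.
      by rewrite ffunE (minn_idPr ki).
    apply/eqP/forallP => [<- i|Ca]; first by rewrite ffunE ltnNge; case: leqP => //= _; rewrite eqxx.
    apply/ffunP => i; rewrite ffunE ffunE; case: leqP => ik; first by rewrite -levelE.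
    by apply/esym/eqP; have := Ca i; rewrite ik.
  have <- : level C k.+1 = a by rewrite -ext_trunc level_ext // ltnn.
  rewrite level_trunc // min0n big_ord_recr /= mulrA mulrC [RHS]mulrC; congr (_ * _).
  rewrite mulrC; congr (_ * _); apply: eq_bigr => i _.
  by rewrite !level_trunc ?(minn_idPl (ltn_ord i)) ?(minn_idPl (ltnW (ltn_ord i))) //;
    have := ltn_ord i; lia.
move=> [b C] /= /forallP Cb; have Ck i : (k <= i <= n)%N -> level C i = b.
  by case/andP=> ki iN; have := Cb (inord i); rewrite inordK // ki => /eqP.
congr (_, _); first by rewrite level_ext ?(ltnW kn) // leqnn Ck // leqnn ltnW.
apply/ffunP => i; rewrite ffunE level_ext; last by rewrite geq_min -ltnS ltn_ord.
rewrite geq_minr levelE; case: (leqP i k) => // ki.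
by rewrite !Ck ?leqnn ?(ltnW kn) // ltnW //= -ltnS.
Qed.

Lemma path_sum a :
  f n a = \sum_(C : {ffun 'I_n.+1 -> A} | level C n == a)
            (\prod_(i < n) w i (level C i.+1) (level C i)) * f 0 (level C 0).
Proof.
rewrite path_sum_prefix //; apply: eq_bigl => C.
apply/forallP/idP => [/(_ (inord n))|/eqP Cn i]; first by rewrite inordK // leqnn.
apply/implyP => ni; rewrite -Cn /level; apply/eqP; congr (C _); apply/val_inj.
by rewrite /= inordK //; apply/eqP; rewrite eqn_leq ni -ltnS ltn_ord.
Qed.
End PathSums.

(** * Counting boxes and columns *)

Local Open Scope nat_scope.

Lemma card_ord_lt m j : j <= m -> #|[set i : 'I_m | i < j]| = j.
Proof.
move=> jm; rewrite -sum1dep_card -(big_ord_widen m (fun => 1)) //.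
by rewrite sum1_card card_ord.
Qed.

(** A down-closed set is an initial segment. This turns cardinalities into comparisons, both for the
    row lengths in [below] and for the values in [entries]. *)
Lemma card_down_closed m (D : {set 'I_m}) :
    (forall i j : 'I_m, i <= j -> j \in D -> i \in D) ->
  forall j : 'I_m, (j \in D) = (j < #|D|).
Proof.
move=> downD j; apply/idP/idP => [Dj|].
  rewrite -(card_ord_lt (ltn_ord j)).
  by apply/subset_leq_card/subsetP => i; rewrite inE ltnS => ij; apply: downD Dj.
apply: contraLR => Dj; rewrite -leqNgt -(card_ord_lt (ltnW (ltn_ord j))).
apply/subset_leq_card/subsetP => i Di; rewrite inE ltnNge.
by apply: contra Dj => ji; apply: downD Di.
Qed.

Lemma sum_ord_interval N a b : b <= N -> \sum_(c < N) (a <= c < b : nat) = b - a.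
Proof.
move=> bN; rewrite -[RHS]muln1 -sum_nat_const_nat big_geq_mkord /=.
by rewrite (big_ord_widen_cond N _ (fun => 1)) // [RHS]big_mkcond.
Qed.

Lemma leq_of_lt a b : (forall c, c < a -> c < b) -> a <= b.
Proof. by case: a => // a; apply. Qed.

Section SkewCounts.
Variables (l N : nat) (la mu : row_lengths l N).
Hypotheses (la_shape : is_shape la) (mu_shape : is_shape mu).

(** Each column meeting [la / mu] is counted once, at its lowest box in [la]; that box lies outside
    [mu] because the parts of [mu] decrease. *)
Lemma card_skew_columns :
  #|[set c : 'I_N | [exists r : 'I_l, part mu r <= c < part la r]]| =
  \sum_(r < l) (part la r - maxn (part mu r) (part la r.+1)).
Proof.
rewrite -sum1dep_card [LHS]big_mkcond /=.
under [RHS]eq_bigr do rewrite -(@sum_ord_interval N) ?part_le //.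
rewrite exchange_big; apply: eq_bigr => c _ /=.
case: existsP => [[r /andP[mu_c c_la]]|no_r]; last first.
  rewrite big1 // => r _; case: andP => // -[]; rewrite geq_max => /andP[mu_c _] c_la.
  by case: no_r; exists r; rewrite mu_c.
have ex_row : exists s, part la s <= c by exists l; rewrite part_default.
(* [s] is the first row of [la] that does not reach column [c], so the lowest box of the column is
   in row [s.-1]. *)
case: (ex_minnP ex_row) => s la_s min_s.
have rs : r < s.
  by rewrite ltnNge; apply: contraL c_la => sr;
    rewrite -leqNgt (leq_trans _ la_s) ?(is_shapeP _ la_shape).
have s_l : s.-1 < l.
  by rewrite prednK ?(leq_ltn_trans _ rs) // min_s // part_default.
have sK : s.-1.+1 = s by rewrite prednK // (leq_ltn_trans _ rs).
have c_s : c < part la s.-1.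
  by rewrite ltnNge; apply: contraTN rs => /min_s; rewrite -{1}sK ltnn.
have mu_s : part mu s.-1 <= c.
  by apply: leq_trans mu_c; apply: (is_shapeP _ mu_shape); rewrite -ltnS sK.
rewrite (bigD1 (Ordinal s_l)) //= sK geq_max la_s mu_s c_s big1 //.
move=> i; rewrite -val_eqE /= => i_s; case: andP => // -[]; rewrite geq_max => /andP[_ la_i] c_i.
have : s <= i.+1 := min_s _ la_i.
rewrite -sK ltnS leq_eqVlt eq_sym (negPf i_s) /= -ltnS sK ltnS => si.
by have := is_shapeP _ la_shape _ _ si; lia.
Qed.

End SkewCounts.

Lemma part_zero l N r : part ([ffun=> ord0] : row_lengths l N) r = 0.
Proof.
have [rl|/part_default->//] := ltnP r l.
by rewrite (part_ord _ (Ordinal rl)) ffunE.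
Qed.

Definition is_skew_shape l N (la mu : row_lengths l N) :=
  [&& is_shape la, is_shape mu & sub_shape mu la].

(** * Reverse plane partitions as chains of shapes *)

Section FillingsAsChains.
Variables (l n : nat) (la : l.-tuple nat).
Hypothesis la_sorted : sorted geq la.
Local Notation N := (head 0 la).
Implicit Types (T : filling la n) (C : {ffun 'I_n.+1 -> row_lengths l N}) (u v : box la).

Definition full_shape : row_lengths l N := [ffun i => inord (tnth la i)].

(** [inord] loses nothing, since the bound [N] is the first and hence the largest part. *)
Lemma part_full r : part full_shape r = nth 0 la r.
Proof.
have [rl|lr] := ltnP r l; last by rewrite part_default // nth_default ?size_tuple.
rewrite (part_ord _ (Ordinal rl)) ffunE inordK (tnth_nth 0) // ltnS -nth0.
have geq_trans : transitive geq by move=> a b c ba ac; apply: leq_trans ac ba.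
by apply: (sorted_leq_nth geq_trans leqnn 0 la_sorted); rewrite ?inE ?size_tuple // (leq_ltn_trans _ rl).
Qed.

Lemma box_col_lt u : box_col u < part full_shape (box_row u).
Proof. by case: u => r c; rewrite part_full /box_row /= -tnth_nth ltn_ord. Qed.

Lemma boxP r c : c < part full_shape r -> exists u, box_row u = r /\ box_col u = c.
Proof.
have [rl|lr] := ltnP r l; last by rewrite part_default.
rewrite part_full -(tnth_nth 0 la (Ordinal rl)) => cr.
by exists (Tagged (fun r => 'I_(tnth la r)) (Ordinal cr)).
Qed.

Lemma is_shape_full : is_shape full_shape.
Proof.
apply/is_shapeP => r s rs; rewrite !part_full.
have [sl|ls] := ltnP s l; last by rewrite nth_default ?size_tuple.
have geq_trans : transitive geq by move=> a b c ba ac; apply: leq_trans ac ba.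
by apply: (sorted_leq_nth geq_trans leqnn 0 la_sorted); rewrite ?inE ?size_tuple // (leq_ltn_trans rs).
Qed.

(* [below T i] is the shape formed by the boxes whose value is less than [i]. *)
Definition below T : {ffun 'I_n.+1 -> row_lengths l N} :=
  [ffun i : 'I_n.+1 => [ffun r : 'I_l =>
     inord #|[set c : 'I_(tnth la r) | T (Tagged (fun r => 'I_(tnth la r)) c) < i]|]].

Lemma part_below T i (r : 'I_l) : i <= n ->
  part (level (below T) i) r =
  #|[set c : 'I_(tnth la r) | T (Tagged (fun r => 'I_(tnth la r)) c) < i]|.
Proof.
move=> i_n; rewrite part_ord /level !ffunE !inordK // ltnS.
rewrite (leq_trans (max_card _)) // card_ord.
by rewrite (tnth_nth 0) -part_full part_le.
Qed.

Lemma part_below_le T i r : i <= n -> part (level (below T) i) r <= part full_shape r.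
Proof.
move=> i_n; have [rl|/part_default->//] := ltnP r l.
rewrite (part_below _ (Ordinal rl)) // (leq_trans (max_card _)) // card_ord.
by rewrite part_full (tnth_nth 0).
Qed.

Lemma is_rppP T : reflect
  ((forall u v, box_row u = box_row v -> box_col u <= box_col v -> T u <= T v) /\
   (forall u v, box_col u = box_col v -> box_row u <= box_row v -> T u <= T v))
  (is_rpp T).
Proof.
apply: (iffP idP) => [/forallP rT|[rowT colT]].
  split=> u v /eqP uv le_uv; have := forallP (rT u) v; rewrite uv le_uv /=.
    by case/andP.
  by case/andP.
apply/forallP => u; apply/forallP => v; apply/andP; split.
  by apply/implyP => /andP[/eqP]; apply: rowT.
by apply/implyP => /andP[/eqP]; apply: colT.
Qed.

(** Weak increase along a row makes its boxes of value less than [i] an initial segment, so its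
    length decides membership. *)
Lemma lt_below T i u : is_rpp T -> i <= n ->
  (T u < i) = (box_col u < part (level (below T) i) (box_row u)).
Proof.
case/is_rppP=> rowT _ i_n; case: u => r c.
rewrite part_below // -card_down_closed ?inE // => a b ab; rewrite !inE.
by apply: leq_ltn_trans; apply: rowT.
Qed.

Definition is_chain C :=
  [&& level C 0 == [ffun=> ord0], level C n == full_shape
    & [forall i : 'I_n, is_skew_shape (level C i.+1) (level C i)]].

Lemma is_chain_below T : is_rpp T -> is_chain (below T).
Proof.
move=> rT; have [rowT colT] := is_rppP _ rT; apply/and3P; split.
- apply/eqP/eq_shape => r rl; rewrite (part_below _ (Ordinal rl)) //.
  rewrite (part_ord _ (Ordinal rl)) ffunE /=; apply: eq_card0 => c.
  by rewrite inE ltn0.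
- apply/eqP/eq_shape => r rl; rewrite (part_below _ (Ordinal rl)) //.
  rewrite part_full -(tnth_nth 0 la (Ordinal rl)) -[RHS]card_ord; apply: eq_card => c.
  by rewrite inE ltn_ord.
(* A box of row [r.+1] in level [i] has above it a box of no larger value, which is therefore in
   level [i] too. *)
have shape_below i : i <= n -> is_shape (level (below T) i).
  move=> i_n; apply/forallP => r; apply: leq_of_lt => c c_lt.
  have [u [ur uc]] := boxP (leq_trans c_lt (part_below_le _ _ i_n)).
  have c_lt' : c < part full_shape r.
    by rewrite (leq_trans c_lt) // (leq_trans (part_below_le _ _ i_n)) // (is_shapeP _ is_shape_full).
  have [v [vr vc]] := boxP c_lt'.
  move: c_lt; rewrite -uc -ur -lt_below // => u_lt.
  rewrite uc -vc -vr -lt_below //; apply: leq_ltn_trans u_lt.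
  apply: colT; first by rewrite uc.
  by rewrite ur vr leqnSn.
apply/forallP => i; rewrite /is_skew_shape !shape_below ?(ltnW (ltn_ord i)) //=.
apply/forallP => r; apply: leq_of_lt => c c_lt.
have i_n := ltnW (ltn_ord i).
have [u [ur uc]] := boxP (leq_trans c_lt (part_below_le _ _ i_n)).
by move: c_lt; rewrite -uc -ur -!lt_below // => /leqW.
Qed.

(** The value at a box can be read off from the levels containing that box. *)
Lemma below_inj : {in is_rpp (n:=n) (la:=la) &, injective below}.
Proof.
move=> T T' rT rT' eqC; apply/ffunP => u; apply/val_inj/eqP.
rewrite eqn_leq -[_ <= T' u]ltnS -[_ <= T u]ltnS; apply/andP; split.
  by rewrite lt_below // eqC -lt_below.
by rewrite lt_below // -eqC -lt_below.
Qed.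

Section Entries.
Variable C : {ffun 'I_n.+1 -> row_lengths l N}.
Hypothesis C_chain : is_chain C.

(** The indices [i] for which [u] is still outside level [i.+1]. They form an initial segment, whose
    size is the value at [u]. *)
Definition entry_set u := [set i : 'I_n | part (level C i.+1) (box_row u) <= box_col u].

Lemma chain_homo i j r : i <= j <= n -> part (level C i) r <= part (level C j) r.
Proof.
case/andP=> /subnK<-; elim: (j - i) => // d IHd dn.
apply: leq_trans (IHd (ltnW dn)) _; rewrite addSn in dn *.
case/and3P: C_chain => _ _ /forallP /(_ (Ordinal dn)) /and3P[_ _ /sub_shapeP]; exact.
Qed.

Lemma entry_subproof u : #|entry_set u| < n.
Proof.
case/and3P: C_chain => /eqP C0 /eqP Cn _.
have := box_col_lt u; rewrite -Cn.
(* If [n = 0], the first and last levels coincide, so the full shape is empty and has no box [u]. *)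
case: (posnP n) => [n0|n_gt0].
  by have -> : level C n = level C 0 by [congr level]; rewrite C0 part_zero.
move=> u_lt; rewrite -[X in _ < X]card_ord; apply/proper_card/properP.
split; first exact/subsetP.
have n1 : n.-1 < n by rewrite prednK.
by exists (Ordinal n1) => //; rewrite inE /= prednK // -ltnNge.
Qed.

Definition entries : filling la n := [ffun u => Ordinal (entry_subproof u)].

Lemma entries_lt u i : i <= n ->
  (entries u < i) = (box_col u < part (level C i) (box_row u)).
Proof.
move=> i_n; rewrite ffunE /=; case: i i_n => [|i] i_n.
  by case/and3P: C_chain => /eqP-> _ _; rewrite part_zero.
have down (j k : 'I_n) : j <= k -> k \in entry_set u -> j \in entry_set u.
  by rewrite !inE => jk; apply: leq_trans; rewrite chain_homo // ltnS jk ltn_ord.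
by rewrite ltnS leqNgt -(card_down_closed down (Ordinal i_n)) inE -ltnNge.
Qed.

Lemma is_shape_chain i : i <= n -> is_shape (level C i).
Proof.
case/and3P: C_chain => /eqP C0 _ /forallP skewC; case: i => [_|i i_n].
  by rewrite C0; apply/forallP => r; rewrite !part_zero.
by case/and3P: (skewC (Ordinal i_n)).
Qed.

Lemma entries_rpp : is_rpp entries.
Proof.
apply/is_rppP; split=> u v uv le_uv; rewrite -ltnS entries_lt //.
  by rewrite uv (leq_ltn_trans le_uv) // -entries_lt.
rewrite uv; apply: (@leq_trans (part (level C (entries v).+1) (box_row v))).
  by rewrite -entries_lt.
exact: (is_shapeP _ (is_shape_chain _)).
Qed.

Lemma below_entries : below entries = C.
Proof.
apply/ffunP => i; have i_n : i <= n by rewrite -ltnS.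
have levelE (D : {ffun 'I_n.+1 -> row_lengths l N}) : D i = level D i by rewrite /level inord_val.
rewrite !levelE.
have C_full r : part (level C i) r <= part full_shape r.
  by case/and3P: C_chain => _ /eqP <- _; rewrite chain_homo // i_n leqnn.
apply/eq_shape => r _; apply/eqP; rewrite eqn_leq; apply/andP; split;
    apply: leq_of_lt => c c_lt.
  have [u [ur uc]] := boxP (leq_trans c_lt (part_below_le _ _ i_n)).
  by move: c_lt; rewrite -ur -uc -lt_below ?entries_rpp // entries_lt.
have [u [ur uc]] := boxP (leq_trans c_lt (C_full r)).
by move: c_lt; rewrite -ur -uc -lt_below ?entries_rpp // entries_lt.
Qed.
End Entries.

Lemma below_image : [set below T | T in is_rpp (n:=n) (la:=la)] =i is_chain.
Proof.
move=> C; apply/imsetP/idP => [[T rT ->]|C_chain]; first exact: is_chain_below.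
by exists (entries C_chain); [apply: entries_rpp | rewrite below_entries].
Qed.

(** The boxes of value [i] form the skew shape between levels [i] and [i.+1]. *)
Lemma ncols_with_below T (i : 'I_n) : is_rpp T ->
  ncols_with T i = \sum_(r < l)
    (part (level (below T) i.+1) r -
     maxn (part (level (below T) i) r) (part (level (below T) i.+1) r.+1)).
Proof.
move=> rT; have chT := is_chain_below rT.
have i_n := ltnW (ltn_ord i).
rewrite -card_skew_columns ?(is_shape_chain chT) //; apply: eq_card => c; rewrite !inE.
apply/existsP/existsP => [[u /andP[/eqP uc /eqP ui]]|[r /andP[c_ge c_lt]]].
  exists (tag u); rewrite -uc -[nat_of_ord (tag u)]/(box_row u).
  by rewrite leqNgt -!lt_below // ui ltnn ltnSn.
have [u [ur uc]] := boxP (leq_trans c_lt (part_below_le _ _ (ltn_ord i))).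
exists u; rewrite uc eqxx -val_eqE eqn_leq /= -[_ <= i]ltnS [i <= _]leqNgt.
by rewrite !lt_below // ur uc c_lt -leqNgt.
Qed.

(** Each difference counts boxes [u] of row [r] outside level [i] with the box below inside level
    [i.+1]. This forces [i] to be [T u] and the box below to have the same value, so summing over
    boxes first gives the count. *)
Lemma nrepeats_below_below T r : is_rpp T -> r.+1 < l ->
  nrepeats_below T r =
  \sum_(i < n) (part (level (below T) i.+1) r.+1 - part (level (below T) i) r).
Proof.
move=> rT rl; have chT := is_chain_below rT; have [_ colT] := is_rppP _ rT.
have row_lt (i : 'I_n) : part (level (below T) i.+1) r.+1 <= part (level (below T) i.+1) r.
  exact: (is_shapeP _ (is_shape_chain chT _)).
have count_boxes (i : 'I_n) :
    part (level (below T) i.+1) r.+1 - part (level (below T) i) r =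
    \sum_(u : box la) ((box_row u == r) &&
      (part (level (below T) i) r <= box_col u < part (level (below T) i.+1) r.+1)).
  have r_l := ltnW rl; rewrite -(@sum_ord_interval (tnth la (Ordinal r_l))); last first.
    by rewrite (tnth_nth 0) -part_full (leq_trans (row_lt i)) ?part_below_le.
  (* The sum over boxes is a sum over rows and then columns, in which only row [r] survives. *)
  rewrite -(sig_big_dep (J := fun q : 'I_l => 'I_(tnth la q)) xpredT (fun _ => xpredT)
    (fun q (c : 'I_(tnth la q)) => ((q == r :> nat) &&
      (part (level (below T) i) r <= c < part (level (below T) i.+1) r.+1) : nat))) /=.
  rewrite (bigD1 (Ordinal r_l)) //= eqxx [X in _ = _ + X]big1 ?addn0 // => q /negPf q_r.
  by rewrite big1 // => c _; rewrite (_ : (q == r :> nat) = false).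
under [RHS]eq_bigr do rewrite count_boxes.
rewrite exchange_big /nrepeats_below -sum1dep_card [LHS]big_mkcond /=; apply: eq_bigr => u _.
case: eqP => [ur|_] /=; last by rewrite big1.
have below_u i : i <= n -> (part (level (below T) i) r <= box_col u) = (i <= T u).
  by move=> i_n; rewrite leqNgt -ur -lt_below // -leqNgt.
rewrite (bigD1 (T u)) //= below_u ?(ltnW (ltn_ord _)) // leqnn /= big1 ?addn0 => [|i].
  case: existsP => [[v /and3P[/eqP vr /eqP vc /eqP vu]]|no_v].
    by rewrite -vr -vc -lt_below // vu ltnSn.
  case: ltnP => // u_lt; case: no_v.
  have [v [vr vc]] := boxP (leq_trans u_lt (part_below_le _ _ (ltn_ord _))).
  exists v; rewrite vr vc !eqxx -val_eqE eqn_leq /= -ltnS lt_below // vr vc u_lt /=.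
  by apply: colT; rewrite // vr ur leqnSn.
rewrite -val_eqE below_u ?(ltnW (ltn_ord _)) //= => i_u; case: andP => // -[i_le u_lt].
have : T u < i.+1 by rewrite lt_below // ur (leq_trans u_lt).
by rewrite ltnS => u_le; rewrite eqn_leq i_le u_le in i_u.
Qed.

End FillingsAsChains.

Local Open Scope ring_scope.

(** * Jacobi-Trudi determinants and their path expansion *)

Section JacobiTrudi.
Variables (R : comNzRingType) (l N : nat) (xs ts : seq R).
Implicit Types la mu : row_lengths l N.

(** Rows count from 0, so row [i] takes the first [i] variables of [ts]. The index [i] is not
    confined to ['I_l], since the recursions also refer to row [l]. *)
Definition jt_row k i (a : nat) : 'rV[R]_l :=
  \row_j complete_homogeneous (take k xs ++ take i ts) (a%:Z + j%:Z - i%:Z).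

Lemma jt_row_rec k i a :
  jt_row k i.+1 a.+1 = ts`_i *: jt_row k i.+1 a + jt_row k i a.
Proof.
apply/rowP => j; rewrite !mxE.
have -> : a.+1%:Z + j%:Z - i.+1%:Z = a%:Z + j%:Z - i%:Z by lia.
have -> : a%:Z + j%:Z - i.+1%:Z = a%:Z + j%:Z - i%:Z - 1 by lia.
(* Past the end of [ts] the default variable is 0 and [take] no longer grows, so the recursion
   persists. *)
have [i_ts|ts_i] := ltnP i (size ts); last first.
  by rewrite nth_default // mul0r add0r !(take_oversize (n := _) (s := ts)) // leqW.
by rewrite (take_nth 0) // -cats1 catA complete_homogeneous_insert cats0 addrC.
Qed.

Lemma jt_row_add_var k i a : (k < size xs)%N ->
  jt_row k.+1 i a.+1 = xs`_k *: jt_row k.+1 i a + jt_row k i a.+1.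
Proof.
move=> k_xs; apply/rowP => j; rewrite !mxE (take_nth 0) // cat_rcons.
rewrite complete_homogeneous_insert [LHS]addrC; congr (_ * complete_homogeneous _ _ + _).
by lia.
Qed.

Lemma jt_row_last k : jt_row k l 0 = 0.
Proof.
apply/rowP => j; rewrite !mxE complete_homogeneous_lt0 //.
by have := ltn_ord j; lia.
Qed.

Definition jacobi_trudi k la := \det (\matrix_(i < l) jt_row k i (part la i)).

(** For the zero shape the matrix is upper unitriangular. Otherwise the first row involves no
    variable and only positive degrees, so it vanishes. *)
Lemma jacobi_trudi_no_vars la : is_shape la ->
  jacobi_trudi 0 la = (la == [ffun=> ord0])%:R.
Proof.
move=> la_shape; case: eqP => [->|la_neq0].
  rewrite /jacobi_trudi -det_tr det_trig.
    rewrite big1 // => i _; rewrite !mxE part_zero add0r subrr.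
    exact: complete_homogeneous0.
  apply/is_trig_mxP => i j ij; rewrite !mxE part_zero complete_homogeneous_lt0 //.
  by lia.
have l_gt0 : (0 < l)%N.
  by rewrite lt0n; apply/eqP => l0; apply/la_neq0/eq_shape => i; rewrite [X in (_ < X)%N]l0.
have la0_gt0 : (0 < part la 0)%N.
  rewrite lt0n; apply/eqP => la0; apply: la_neq0; apply: eq_shape => i _.
  by rewrite part_zero; apply/eqP; rewrite -leqn0 -la0; apply: (is_shapeP _ la_shape).
rewrite /jacobi_trudi (expand_det_row _ (Ordinal l_gt0)) big1 // => j _.
rewrite !mxE !take0 cats0 complete_homogeneous_nil (_ : (_ == 0) = false) ?mul0r //.
by move: la0_gt0 => /=; set p := part la 0; case: p.
Qed.

(** Extended by 0, so that paths may run through all [row_lengths]. *)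
Definition step_weight k la mu : R :=
  if is_skew_shape la mu then \prod_(r < l) row_weight (xs`_k) (nth 0 ts) (part la) (part mu) r
  else 0.

Lemma jacobi_trudi_paths la : is_shape la ->
  jacobi_trudi (size xs) la =
  \sum_(C : {ffun 'I_(size xs).+1 -> row_lengths l N} | level C (size xs) == la)
    (\prod_(i < size xs) step_weight i (level C i.+1) (level C i)) *
    (level C 0 == [ffun=> ord0])%:R.
Proof.
(* Setting [f] to 0 off the shapes makes the recursion hold for every family of row lengths. *)
move=> la_shape; pose f k mu := if is_shape mu then jacobi_trudi k mu else 0.
have f0 mu : f 0%N mu = (mu == [ffun=> ord0])%:R.
  rewrite /f; case: ifP => [/jacobi_trudi_no_vars //|/negP mu_shape].
  case: eqP => // mu0; case: mu_shape; rewrite mu0.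
  by apply/forallP => r; rewrite !part_zero.
transitivity (f (size xs) la); first by rewrite /f la_shape.
rewrite (path_sum (w := step_weight)); first by apply: eq_bigr => C _; rewrite f0.
move=> k mu k_xs; rewrite /f; case: ifP => mu_shape; last first.
  by rewrite big1 // => nu _; rewrite /step_weight /is_skew_shape mu_shape mul0r.
rewrite /jacobi_trudi (det_transfer (u := jt_row k) (y := xs`_k) (t := nth 0 ts)) //.
- rewrite big_mkcond; apply: eq_bigr => nu _.
  rewrite /step_weight /is_skew_shape mu_shape /=; case: is_shape => /=; last by rewrite mul0r.
  by case: sub_shape; rewrite ?mul0r.
- exact: jt_row_rec.
- exact: jt_row_rec.
- by move=> i a; apply: jt_row_add_var.
- exact: jt_row_last.
- exact: jt_row_last.
Qed.

End JacobiTrudi.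

(** * Comparison of the two sums over chains *)

Lemma rpp_sum_jacobi_trudi (R : comNzRingType) l n (la : l.-tuple nat) (xs ts : seq R) :
    size xs = n -> sorted geq la ->
  \sum_(T : filling la n | is_rpp T)
    (\prod_(r < l.-1) ts`_r ^+ nrepeats_below T r) *
    (\prod_(i < n) xs`_i ^+ ncols_with T i) =
  jacobi_trudi xs ts n (full_shape la).
Proof.
move=> <- la_sorted.
rewrite jacobi_trudi_paths ?is_shape_full //.
(* The weight of a filling factors over the steps of its chain. *)
rewrite (eq_bigr (fun T => \prod_(i < size xs) step_weight xs ts i
   (level (below T) i.+1) (level (below T) i))); last first.
  move=> T rT; have chT := is_chain_below la_sorted rT.
  have skewT (i : 'I_(size xs)) : is_skew_shape (level (below T) i.+1) (level (below T) i).
    by case/and3P: chT => _ _ /forallP.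
  under [RHS]eq_bigr do rewrite /step_weight skewT big_split /=.
  rewrite big_split /= mulrC; congr (_ * _).
    by apply: eq_bigr => i _; rewrite ncols_with_below // expr_sum.
  rewrite exchange_big /=.
  under [RHS]eq_bigr do rewrite -expr_sum.
  pose F r := ts`_r ^+ (\sum_(i < size xs)
    (part (level (below T) i.+1) r.+1 - part (level (below T) i) r))%N.
  transitivity (\prod_(r < l) F r); last by [].
  transitivity (\prod_(r < l.-1) F r).
    apply: eq_bigr => r _; rewrite nrepeats_below_below //.
    by rewrite -ltn_predRL.
  (* Nothing lies below row [l.-1], so its factor is 1 and the product may be extended to all
     rows. *)
  rewrite -!(big_mkord xpredT); case: (posnP l) => [l0|l_gt0].
    by rewrite !big_geq // l0.
  rewrite -[in RHS](prednK l_gt0) big_nat_recr //= [F l.-1](_ : _ = 1) ?mulr1 //.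
  by rewrite /F big1 // => i _; rewrite part_default // prednK.
transitivity (\sum_(C : {ffun 'I_(size xs).+1 -> row_lengths l (head 0%N la)} |
    is_chain (la := la) C)
  \prod_(i < size xs) step_weight xs ts i (level C i.+1) (level C i)).
  rewrite -(eq_bigl _ _ (below_image la_sorted)) big_imset //.
  exact: below_inj.
(* The start of a chain comes from the indicator factor, its end from the range of summation, and
   its skew steps from the vanishing of [step_weight]. *)
rewrite [LHS]big_mkcond [RHS]big_mkcond; apply: eq_bigr => C _ /=.
rewrite /is_chain; case: eqP => _; rewrite ?mulr1 ?mulr0 ?if_same //=.
case: eqP => //= _; case: (boolP [forall i, _]) => [//|/forallPn[i not_skew]].
by rewrite (bigD1 i) //= /step_weight (negPf not_skew) mul0r.
Qed.

Theorem corollary3p10 (n l : nat) (la : l.-tuple nat) (hla : is_partition la) :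
  refined_dual_grothendieck n la =
  \det (\matrix_(i < l, j < l)
          complete_homogeneous (xvars n l ++ take i (tvars n l))
            ((tnth la i)%:Z + j%:Z - i%:Z)).
Proof.
case/andP: hla => la_sorted _.
have size_x : size (xvars n l) = n by rewrite size_map size_enum_ord.
have x_nth (i : 'I_n) : (xvars n l)`_i = xvar l i.
  by rewrite (nth_map i) ?size_enum_ord // nth_ord_enum.
have t_nth (r : 'I_l.-1) : (tvars n l)`_r = tvar n r.
  by rewrite (nth_map r) ?size_enum_ord // nth_ord_enum.
have -> : refined_dual_grothendieck n la = 
  \sum_(T : filling la n | is_rpp T)
    (\prod_(r < l.-1) (tvars n l)`_r ^+ nrepeats_below T r) *
    (\prod_(i < n) (xvars n l)`_i ^+ ncols_with T i).
  apply: eq_bigr => T _; congr (_ * _); first by apply: eq_bigr => r _; rewrite t_nth.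
  by apply: eq_bigr => i _; rewrite x_nth.
rewrite (rpp_sum_jacobi_trudi _ size_x la_sorted); congr (\det _).
apply/matrixP => i j; rewrite !mxE part_full // -tnth_nth.
by rewrite take_oversize // size_x.
Qed.
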